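(* Let $G$ be a planar graph that contains no kites and has maximum degree $\Delta(G)\geq 7$. Then $\chi''_l(G)\leq \Delta(G)+2$.
   Context: All graphs are finite and without loops or multiple edges. $\Delta(G)$ denotes the maximum degree of $G$. A kite is a subgraph formed by two (distinct) 3-cycles that share an edge; ''contains no kites'' means that no two distinct 3-cycles of $G$ share an edge. A proper total-coloring of $G$ assigns a color to each $x\in V(G)\cup E(G)$ so that adjacent vertices receive different colors, distinct edges sharing an endpoint receive different colors, and each edge receives a color different from the colors of its two endpoints. The list total chromatic number $\chi''_l(G)$ is the least integer $k$ such that, for every assignment $L$ of a list $L(x)$ of colors to each $x\in V(G)\cup E(G)$ with $|L(x)|\geq k$ for all $x$, there is a proper total-coloring of $G$ in which each $x$ receives a color from $L(x)$. *)

(* Defs.v *)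
From mathcomp Require Import all_boot all_order all_algebra finmap.
From mathcomp Require Import boolp classical_sets set_interval reals topology normedtype.

Set Implicit Arguments.
Unset Strict Implicit.
Unset Printing Implicit Defensive.

Import numFieldNormedType.Exports.

Local Open Scope nat_scope.

Record sgraph := SGraph {
  vertex :> finType;
  adj : rel vertex;
  adj_sym : symmetric adj;
  adj_irr : irreflexive adj }.

(* Edges are unordered: the edge joining x and y is the set {x, y}. *)
Definition edges (G : sgraph) : {set {set G}} :=
  [set A : {set G} |
    [exists x, exists y, adj x y && (A == [set x; y]%SET)]]%SET.

Definition edge (G : sgraph) : finType := {A : {set G} | A \in edges G}.

Definition max_degree (G : sgraph) : nat :=
  \max_(x : G) #|[set y | adj x y]%SET|.

(* In a simple graph a 3-cycle is determined by its set of vertices, and its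
   edges are exactly the edges of the graph contained in that set. *)
Definition three_cycle (G : sgraph) (T : {set G}) : bool :=
  (#|T| == 3) && [forall x in T, forall y in T, (x != y) ==> adj x y].

Definition kite_free (G : sgraph) : Prop :=
  forall (T1 T2 : {set G}) (A : edge G), three_cycle T1 -> three_cycle T2 ->
    val A \subset T1 -> val A \subset T2 -> T1 = T2.

Section PlaneDrawing.
Local Open Scope classical_set_scope.
Local Open Scope ring_scope.

(* A drawing in the plane without crossings: [p x] is the point representing
   the vertex x, and the edge A is represented by the simple arc parametrized
   by the restriction of [f A] to [0, 1]. *)
Definition plane_drawing (R : realType) (G : sgraph)
    (p : G -> R * R) (f : edge G -> R -> R * R) : Prop :=
  [/\ injective p,
      forall A : edge G,
        [/\ {within `[0, 1], continuous (f A)},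
            {in `[0, 1] &, injective (f A)}
          & exists x y : G,
              [/\ val A = [set x; y]%SET, f A 0 = p x & f A 1 = p y]],
      forall (A : edge G) (x : G), {in `]0, 1[, forall t, f A t <> p x}
    & forall A B : edge G, A != B ->
        {in `]0, 1[ &, forall s t, f A s <> f B t}].

End PlaneDrawing.

Definition planar (R : realType) (G : sgraph) : Prop :=
  exists (p : G -> R * R) (f : edge G -> R -> R * R), plane_drawing p f.

(* The disjoint union G + edge G is the set of all vertices and edges of G. *)
Definition proper_total_coloring (G : sgraph) (C : eqType)
    (c : G + edge G -> C) : Prop :=
  [/\ forall x y : G, adj x y -> c (inl x) != c (inl y),
      forall (A B : edge G) (x : G), A != B -> x \in val A -> x \in val B ->
        c (inr A) != c (inr B)
    & forall (A : edge G) (x : G), x \in val A -> c (inr A) != c (inl x)].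

Definition total_choosable (G : sgraph) (k : nat) : Prop :=
  forall (C : choiceType) (L : G + edge G -> {fset C}),
    (forall z, k <= #|` L z|) ->
    exists c : G + edge G -> C,
      proper_total_coloring c /\ forall z, c z \in L z.

Lemma fset_distinct_choice (I : finType) (C : choiceType) (L : I -> {fset C})
    (c0 : C) (s : seq I) :
  uniq s -> (forall i, #|I| <= #|` L i|) ->
  exists c : I -> C, {in s &, injective c} /\ {in s, forall i, c i \in L i}.
Proof.
move=> + cL; elim: s => [|i s IH] /=; first by exists (fun=> c0).
case/andP=> iNs us; have [c [c_inj c_in]] := IH us.
have [a aL aNs] : exists2 a, a \in L i & a \notin map c s.
  have /negP nsub : ~~ (L i `<=` [fset a in map c s])%fset.
    apply/negP => /fsubset_leq_card; rewrite leqNgt => /negP; apply.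
    apply: leq_trans (cL i); rewrite card_fseq.
    apply: leq_ltn_trans (size_undup _) _; rewrite size_map.
    have /card_uniqP/= <- : uniq (i :: s) by rewrite /= iNs.
    exact: max_card.
  apply: contrapT => no; apply: nsub; apply/fsubsetP => a aL; rewrite inE.
  by apply: contrapT => /negP aNs; apply: no; exists a.
exists (fun j => if j == i then a else c j); split.
  move=> j k; rewrite !inE.
  case: (eqVneq j i) => [->|ji] /= js; case: (eqVneq k i) => [->|ki] //= ks.
  - by move=> ac; rewrite ac map_f in aNs.
  - by move=> ac; rewrite -ac map_f in aNs.
  - exact: c_inj.
by move=> j; rewrite inE; case: (eqVneq j i) => [->|_] //= /c_in.
Qed.

Lemma total_choosable_card (G : sgraph) : total_choosable G #|{: G + edge G}|.
Proof.
move=> C L cL.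
have [c [c_inj c_in]] : exists c : G + edge G -> C,
    injective c /\ forall z, c z \in L z.
  have [z0 _|no] := pickP {: G + edge G}; last first.
    have em (z : G + edge G) : False by have := no z.
    by exists (fun z => False_rect _ (em z)); split=> z; case: (em z).
  have /fset0Pn[c0 _] : L z0 != fset0.
    rewrite -cardfs_gt0; apply: leq_trans (cL z0).
    by apply/card_gt0P; exists z0.
  have [c [c_inj c_in]] := fset_distinct_choice c0 (enum_uniq {: G + edge G}) cL.
  exists c; split=> [x y|z].
    by apply: (c_inj x y); rewrite mem_enum.
  by apply: c_in; rewrite mem_enum.
exists c; split=> //; split=> [x y xy|A B x AB _ _|A x _].
- by apply/eqP => /c_inj[xy']; rewrite xy' adj_irr in xy.
- by apply/eqP => /c_inj[AB']; rewrite AB' eqxx in AB.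
- by apply/eqP => /c_inj.
Qed.

Lemma total_choosable_ex (G : sgraph) :
  exists k, (fun k => `[< total_choosable G k >]) k.
Proof. by exists #|{: G + edge G}|; apply/asboolP/total_choosable_card. Qed.

Definition list_total_chromatic_number (G : sgraph) : nat :=
  ex_minn (total_choosable_ex G).

(* Main.v *)
Require Import Defs.
From mathcomp Require Import boolp classical_sets reals.
From mathcomp Require Import topology normedtype derive.
From mathcomp Require Import all_boot all_order all_algebra finmap zify lra.

(** Put k = Delta(G) and let every list have at least k + 2 colours. The proof
    takes an edge set F of G, of least size, that cannot be coloured, and
    contradicts the planarity of G by counting. All spanning subgraphs of G are
    represented by such edge sets, so that deleting an edge changes neither the
    vertex type nor the drawing.

    Reduction ([colorable_add_edge]). If an edge xy of F satisfies d(x) <= 4 and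
    d(x) + d(y) <= k + 2, then a colouring of F - xy extends to F: erase the
    colour of x, colour xy, then colour x. So in F a vertex of degree d <= 4 has
    only neighbours of degree at least k + 3 - d. In particular degrees 1 and 2
    do not occur, and the neighbours of a vertex of degree 3 have degree k.

    Discharging ([discharging]). Give each vertex of positive degree the charge
    d(v) - 4. Each vertex of degree at least 5 gives 1/2 to every triangle on
    it, and each vertex gives 1/3 to every neighbour of degree 3. Every triangle
    has at least two corners of degree at least 5, so it receives at least 1;
    every vertex of degree 3 receives exactly 1; and since triangles share no
    edge, no vertex is left with a negative charge. Hence the sum of d(v) - 4 is at
    least the number T of triangles, that is, 4 V + T <= 2 |F|.

    Planarity ([planar_euler]). On the other hand 2 |F| + 4 <= 4 V + T, because
    of a family S of nonempty even subgraphs of F, the face boundaries, that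
    spans the cycle space over the field with two elements and uses every edge
    at most twice, as in MacLane's criterion. Its size is at least the dimension
    |F| - V + 1 of the cycle space, and its members have at least 4 edges,
    except for triangles, which have 3 ([euler_inequality]).

    To find S, the drawing is rounded to a fine grid. Each edge becomes a grid
    walk that runs through cells owned by one end, then passes a unit edge, its
    gate, and runs through cells owned by the other end ([planar_euler]). The
    faces are the classes of unit squares that cannot be separated by functions
    constant across the unit edges on no walk. Ray casting gives a function of
    this kind for every cycle, the parity of its winding number, and the cycle
    is read off from the values on the two sides of the gates
    ([winding_gate]); conversely every such function gives a cycle
    ([cut_cycle]). So the cycle space is a cut space of the graph with the faces
    as vertices, and there the stars of the vertices span. *)

Set Implicit Arguments.
Unset Strict Implicit.
Unset Printing Implicit Defensive.

Local Open Scope set_scope.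
Local Open Scope nat_scope.

(** * Edge sets and degrees *)

Section EdgeSets.
Variable G : sgraph.
Implicit Types (F : {set edge G}) (A B : edge G) (x y u v w : G).

Lemma edgeP A : exists x y, adj x y /\ val A = [set x; y].
Proof.
have := valP A; rewrite inE => /existsP[x /existsP[y /andP[xy /eqP eA]]].
by exists x, y.
Qed.

Lemma card_edge A : #|val A| = 2.
Proof.
have [x [y [xy ->]]] := edgeP A.
by rewrite cards2; case: eqVneq xy => // ->; rewrite adj_irr.
Qed.

Lemma edge_ends A x y : x \in val A -> y \in val A -> x != y ->
  val A = [set x; y].
Proof.
move=> xA yA xy; apply/esym/eqP; rewrite eqEcard card_edge cards2 xy andbT.
by rewrite subUset !sub1set xA.
Qed.

Lemma edge_adj A x y : x \in val A -> y \in val A -> x != y -> adj x y.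
Proof.
have [u [v [uv ->]]] := edgeP A; rewrite !inE.
case/orP=> /eqP-> /orP[]/eqP->; rewrite ?eqxx // adj_sym; by rewrite ?uv // adj_sym.
Qed.

Lemma adj_edge x y : adj x y -> exists A, val A = [set x; y].
Proof.
move=> xy; have xyE : [set x; y] \in edges G.
  by rewrite inE; apply/existsP; exists x; apply/existsP; exists y; rewrite xy /=.
by exists (exist (fun X : {set G} => X \in edges G) _ xyE).
Qed.

Lemma other_end A x : x \in val A -> exists y, x != y /\ val A = [set x; y].
Proof.
have [u [v [uv eA]]] := edgeP A.
have uNv : u != v by apply: contraTneq uv => ->; rewrite adj_irr.
rewrite eA !inE => /orP[]/eqP->; first by exists v.
by exists u; rewrite eq_sym setUC.
Qed.

Definition edges_at F x := [set A in F | x \in val A].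

Definition nbrs F x := [set y | (y != x) && [exists A in F, val A == [set x; y]]].

Definition deg F x := #|nbrs F x|.

Lemma nbrsP F x y :
  reflect (exists A, [/\ A \in F, x != y & val A = [set x; y]]) (y \in nbrs F x).
Proof.
rewrite inE; apply: (iffP andP) => [[yx /existsP[A /andP[AF /eqP eA]]]|].
  by exists A; rewrite eq_sym.
move=> [A [AF xy eA]]; split; first by rewrite eq_sym.
by apply/existsP; exists A; rewrite AF eA /=.
Qed.

Lemma nbrs_sym F x y : (y \in nbrs F x) = (x \in nbrs F y).
Proof.
by apply/nbrsP/nbrsP => -[A [AF xy eA]]; exists A; rewrite eq_sym setUC.
Qed.

Lemma nbrs_adj F x y : y \in nbrs F x -> adj x y.
Proof.
by case/nbrsP=> A [_ xy eA]; apply: (@edge_adj A); rewrite // eA !inE eqxx ?orbT.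
Qed.

Lemma mem_nbrs F A x y : A \in F -> x \in val A -> y \in val A -> x != y ->
  y \in nbrs F x.
Proof. by move=> AF xA yA xy; apply/nbrsP; exists A; split=> //; apply: edge_ends. Qed.

Lemma card_edges_at F x : #|edges_at F x| = deg F x.
Proof.
rewrite -(card_imset _ val_inj) /deg.
have inj : {in nbrs F x &, injective (fun y => [set x; y])}.
  move=> y z; rewrite !inE => /andP[yx _] /andP[zx _] /setP/(_ y).
  by rewrite !inE eqxx orbT (negbTE yx) => /esym/eqP.
rewrite -(card_in_imset inj); apply: eq_card => X.
apply/imsetP/imsetP => [[A]|[y]].
  rewrite inE => /andP[AF xA ->]; have [y [xy eA]] := other_end xA.
  by exists y => //; apply/nbrsP; exists A.
case/nbrsP=> A [AF xy eA] ->; exists A => //.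
by rewrite inE AF eA !inE eqxx.
Qed.

Lemma sum_deg F : \sum_x deg F x = 2 * #|F|.
Proof.
under eq_bigr => x _ do rewrite -card_edges_at -sum1_card.
under eq_bigr => x _ do under eq_bigl => A do rewrite inE.
rewrite (exchange_big_dep (mem F)) /=; last by move=> x A _ /andP[].
rewrite mulnC -sum_nat_const; apply: eq_bigr => A AF.
by rewrite -(card_edge A) -sum1_card; apply: eq_bigl => x; rewrite AF.
Qed.

Definition covered F := [set x | 0 < deg F x].

Definition triangles F :=
  [set T : {set G} | (#|T| == 3) &&
    [forall x in T, forall y in T, (x != y) ==> (y \in nbrs F x)]].

Lemma trianglesP F (T : {set G}) :
  reflect (#|T| = 3 /\ {in T &, forall x y, x != y -> y \in nbrs F x})
          (T \in triangles F).
Proof.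
rewrite inE; apply: (iffP andP) => [[/eqP -> /forall_inP H]|[-> H]]; split=> //.
  by move=> x y xT yT xy; move/forall_inP: (H x xT) => /(_ y yT)/implyP; apply.
apply/forall_inP => x xT; apply/forall_inP => y yT; apply/implyP; exact: H.
Qed.

Lemma triangle_three_cycle F T : T \in triangles F -> three_cycle T.
Proof.
case/trianglesP=> T3 H; rewrite /three_cycle T3 /=.
apply/forall_inP => x xT; apply/forall_inP => y yT; apply/implyP => xy.
exact: nbrs_adj (H x y xT yT xy).
Qed.

End EdgeSets.

(** * Extending list total colourings *)

Section Colouring.
Variables (G : sgraph) (C : choiceType).
Implicit Types (F : {set edge G}) (L : G + edge G -> {fset C}).

Lemma fresh_color (X : {fset C}) (s : seq C) : size s < #|` X| ->
  exists2 a, a \in X & a \notin s.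
Proof.
move=> sX; have /negP nsub : ~~ (X `<=` [fset a in s])%fset.
  apply/negP => /fsubset_leq_card; rewrite card_fseq leqNgt => /negP; apply.
  exact: leq_ltn_trans (size_undup _) sX.
apply: contrapT => no; apply: nsub; apply/fsubsetP => a aX; rewrite inE.
by apply: contrapT => /negP aNs; apply: no; exists a.
Qed.

Definition colorable F L := exists c : G + edge G -> C,
  [/\ forall A x y, A \in F -> x \in val A -> y \in val A -> x != y ->
        c (inl x) != c (inl y),
      forall A B x, A \in F -> B \in F -> A != B -> x \in val A -> x \in val B ->
        c (inr A) != c (inr B),
      forall A x, A \in F -> x \in val A -> c (inr A) != c (inl x)
    & forall z, c z \in L z].

Lemma colorable0 L : (forall z, 0 < #|` L z|) -> colorable set0 L.
Proof.
move=> L0; have ex z : exists a, a \in L z.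
  by have [] := @fresh_color (L z) [::] (L0 z) => a; exists a.
exists (fun z => xchoose (ex z)); split=> [A x y|A B x|A x|z]; rewrite ?in_set0 //.
exact: xchooseP.
Qed.

(** The edge A sees the colour of y and those of the other edges at x and y,
    at most k + 1 colours once x is uncoloured. Afterwards x sees the colours of
    its neighbours and of its edges, again at most k + 1. *)
Lemma colorable_add_edge k F L (A : edge G) (x y : G) :
  (forall z, k.+2 <= #|` L z|) ->
  A \in F -> x \in val A -> y \in val A -> x != y ->
  2 * deg F x <= k.+1 -> deg F x + deg F y <= k.+2 ->
  colorable (F :\ A) L -> colorable F L.
Proof.
move=> kL AF xA yA xy dx dxy [c [cV cE cI cL]].
have eA := edge_ends xA yA xy.
have Ax : A \in edges_at F x by rewrite inE AF.
have Ay : A \in edges_at F y by rewrite inE AF.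
pose S := (edges_at F x :\ A) :|: (edges_at F y :\ A).
have cardS : #|S| <= k.
  have := cardsD1 A (edges_at F x); have := cardsD1 A (edges_at F y).
  have := cardsU (edges_at F x :\ A) (edges_at F y :\ A).
  rewrite Ax Ay !card_edges_at -/S; move: dxy; lia.
have [a aL] := @fresh_color (L (inr A)) (c (inl y) :: [seq c (inr B) | B in S])
  ltac:(by rewrite /= size_image; apply: leq_ltn_trans (kL _); rewrite ltnS).
rewrite inE negb_or => /andP[ay aS].
have [c1 [c1A c1N c1V]] : exists c1 : G + edge G -> C,
    [/\ c1 (inr A) = a, forall B, B != A -> c1 (inr B) = c (inr B)
      & forall z, c1 (inl z) = c (inl z)].
  exists (fun z => if z is inr B then if B == A then a else c z else c z).
  by split=> [|B /negbTE->|] //; rewrite eqxx.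
have [b bL] := @fresh_color (L (inl x))
    ([seq c1 (inr B) | B in edges_at F x] ++ [seq c (inl w) | w in nbrs F x])
  ltac:(by rewrite size_cat !size_image card_edges_at; apply: leq_trans (kL _);
        rewrite ltnS addnn -mul2n).
rewrite mem_cat negb_or => /andP[bE bV].
have aS' B z : B \in F -> B != A -> z \in val A -> z \in val B -> c (inr B) != a.
  move=> BF BA zA zB; apply: contraNneq aS => <-; apply: image_f.
  move: zA; rewrite eA !inE BA BF => /orP[]/eqP ez; subst z; by rewrite zB ?orbT.
have bV' A' z : A' \in F -> x \in val A' -> z \in val A' -> z != x -> c (inl z) != b.
  move=> AF' xA' zA' zx; apply: contraNneq bV => <-; apply: image_f.
  by apply: (mem_nbrs AF') => //; rewrite eq_sym.
have bE' A' : A' \in F -> x \in val A' -> c1 (inr A') != b.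
  by move=> AF' xA'; apply: contraNneq bE => <-; apply: image_f; rewrite inE AF'.
exists (fun z => if z == inl x then b else c1 z); split.
- move=> A' u v AF' uA vA uv; rewrite !c1V.
  case: ifPn => [/eqP[ux]|ux]; case: ifPn => [/eqP[vx]|vx] //.
  + by rewrite ux vx eqxx in uv.
  + by subst u; rewrite eq_sym; apply: bV' vA _ => //; rewrite eq_sym.
  + by subst v; apply: bV' uA _.
  + have [A'A|A'A] := eqVneq A' A; last by apply: (cV A') => //; rewrite !inE A'A.
    subst A'; move: uA vA uv; rewrite eA !inE.
    by case/orP=> /eqP eu /orP[]/eqP ev; subst u v; rewrite ?eqxx // in ux vx *.
- move=> A' B z AF' BF AB zA zB /=.
  have [eA'|A'A] := eqVneq A' A.
    subst A'; rewrite c1A c1N; last by rewrite eq_sym.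
    by rewrite eq_sym; apply: aS' zB => //; rewrite eq_sym.
  have [eB|BA] := eqVneq B A; first by subst B; rewrite c1A c1N //; apply: aS' zA.
  by rewrite !c1N //; apply: cE zA zB => //; rewrite !inE ?A'A ?BA.
- move=> A' z AF' zA /=; case: ifPn => [/eqP[ez]|zx]; rewrite ?c1V.
    by subst z; apply: bE'.
  have [eA'|A'A] := eqVneq A' A; last first.
    by rewrite c1N //; apply: cI => //; rewrite !inE A'A.
  subst A'; rewrite c1A; move: zA; rewrite eA !inE => /orP[]/eqP ez; subst z => //.
  by rewrite eqxx in zx.
- move=> [z|B]; first by case: ifPn => [/eqP[->]|_]; rewrite ?c1V.
  by have [->|BA] := eqVneq B A; rewrite /= ?c1A ?c1N.
Qed.

End Colouring.

Section Reduction.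
Variable G : sgraph.
Implicit Types (F : {set edge G}).

Lemma deg_max F x : deg F x <= max_degree G.
Proof.
apply: leq_trans (leq_bigmax x); apply/subset_leq_card/subsetP => y /nbrs_adj.
by rewrite inE.
Qed.

(** When k is at least 7, a degree of at most 4 meets the condition on [deg F x]
    in [colorable_add_edge]. *)
Definition light_edge_free k F := forall A x y, A \in F -> x \in val A -> y \in val A ->
  x != y -> deg F x <= 4 -> k + 3 <= deg F x + deg F y.

(** A smallest edge set that cannot be coloured is nonempty, and
    [colorable_add_edge] applies to none of its edges. *)
Lemma choosable_of_light_edges k : 7 <= k ->
  (forall F, F != set0 -> ~ light_edge_free k F) -> total_choosable G (k + 2).
Proof.
move=> k7 noF C L kL; rewrite addn2 in kL.
suff: colorable setT L.
  case=> c [cV cE cI cL]; exists c; split=> //; split=> [x y xy|A B x|A x xA].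
  - have [A eA] := adj_edge xy; apply: (cV A); rewrite ?eA ?set21 ?set22 ?in_setT //.
    by apply: contraTneq xy => ->; rewrite adj_irr.
  - by apply: cE.
  - exact: cI.
have [n] := ubnP #|[set: edge G]|; elim: n [set: edge G] => // n IH F Fn.
have [->|F0] := eqVneq F set0.
  by apply: colorable0 => z; apply: leq_trans (kL z).
have /existsNP[A /existsNP[x /existsNP[y]]] := noF F F0.
move=> /not_implyP[AF /not_implyP[xA /not_implyP[yA /not_implyP[xy]]]].
move=> /not_implyP[dx /negP].
rewrite -ltnNge => dxy.
apply: (colorable_add_edge kL AF xA yA xy); [lia|lia|].
by apply: IH; have := cardsD1 A F; rewrite AF; move: Fn; lia.
Qed.

End Reduction.

(** * Discharging *)

(** Count the pairs (w, S) with w in both S and X: every w lies in at most one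
    member of P. *)
Lemma leq_card_separated (T : finType) m (P : {set {set T}}) (X : {set T}) :
  (forall w S1 S2, w \in X -> S1 \in P -> S2 \in P -> w \in S1 -> w \in S2 -> S1 = S2) ->
  {in P, forall S, m <= #|S :&: X|} -> m * #|P| <= #|X|.
Proof.
move=> uX mP; rewrite mulnC -sum_nat_const.
apply: (@leq_trans (\sum_(S in P) \sum_(w in X | w \in S) 1)).
  apply: leq_sum => S SP; rewrite sum1_card; apply: leq_trans (mP S SP) _.
  by apply/subset_leq_card/subsetP => w; rewrite !inE andbC.
rewrite (exchange_big_dep (mem X)) /=; last by move=> S w _ /andP[].
rewrite -sum1_card; apply: leq_sum => w wX; rewrite sum1dep_card.
apply/card_le1P => S; rewrite !inE => /andP[SP /andP[_ wS]] S'; rewrite !inE.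
apply/idP/eqP => [/andP[S'P /andP[_ wS']]|->]; last by rewrite SP wX wS.
exact: (uX w _ _ wX S'P SP wS' wS).
Qed.

Section Discharging.
Variable G : sgraph.
Implicit Types (F : {set edge G}) (x y u v w : G).

Definition triangles_at F v := [set T in triangles F | v \in T].

Definition nbrs3 F v := [set w in nbrs F v | deg F w == 3].

Lemma sum_nbrs3 F : \sum_v #|nbrs3 F v| = 3 * #|[set v | deg F v == 3]|.
Proof.
under eq_bigr => v _ do rewrite -sum1_card.
under eq_bigr => v _ do under eq_bigl => w do rewrite inE.
rewrite (exchange_big_dep (fun w => deg F w == 3)) /=; last by move=> v w _ /andP[].
rewrite mulnC -sum_nat_const; apply: eq_big => [w|w /eqP dw]; first by rewrite inE.
rewrite -dw /deg -sum1_card; apply: eq_bigl => v.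
by rewrite nbrs_sym eqxx andbT.
Qed.

Hypothesis kfG : kite_free G.

(** This is the only use of the absence of kites: a triangle at v is determined
    by any of its two edges at v. *)
Lemma triangles_share_nbr F v w T1 T2 : w \in nbrs F v ->
  T1 \in triangles_at F v -> T2 \in triangles_at F v -> w \in T1 -> w \in T2 -> T1 = T2.
Proof.
move=> /nbrsP[A [AF vw eA]]; rewrite ![_ \in triangles_at _ _]inE.
move=> /andP[t1 v1] /andP[t2 v2] w1 w2.
apply: (kfG (A := A)); rewrite ?eA ?subUset ?sub1set ?v1 ?v2 //.
  exact: triangle_three_cycle t1.
exact: triangle_three_cycle t2.
Qed.

Lemma triangle_nbrs F v T : T \in triangles_at F v -> T :&: nbrs F v = T :\ v.
Proof.
rewrite inE => /andP[/trianglesP[T3 TH] vT]; apply/setP => w; rewrite !in_setI in_setD1.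
case: eqVneq => [->|wv]; first by rewrite [_ \in nbrs F v]inE eqxx andbF.
by case: (boolP (w \in T)) => //= wT; rewrite (TH v w) // eq_sym.
Qed.

Lemma double_triangles_at F v : 2 * #|triangles_at F v| <= deg F v.
Proof.
apply: leq_card_separated => [w T1 T2|T TT]; first exact: triangles_share_nbr.
rewrite triangle_nbrs //; move: TT; rewrite inE => /andP[/trianglesP[T3 _] vT].
by have := cardsD1 v T; rewrite vT T3; lia.
Qed.

Variable k : nat.
Hypothesis k7 : 7 <= k.

Variable F : {set edge G}.
Hypothesis degF : forall x, deg F x <= k.
Hypothesis lightF : light_edge_free k F.

Lemma light_nbrs x y : y \in nbrs F x -> deg F x <= 4 -> k + 3 <= deg F x + deg F y.
Proof.
by case/nbrsP=> A [AF xy eA]; apply: (lightF AF); rewrite // eA ?set21 ?set22.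
Qed.

(** Vertices of degree 3 are not adjacent, so a triangle at v has a corner other
    than v whose degree is not 3, and distinct triangles have distinct corners. *)
Lemma triangles_at_nbrs3 v : #|triangles_at F v| + #|nbrs3 F v| <= deg F v.
Proof.
have <- : #|nbrs F v :\: nbrs3 F v| + #|nbrs3 F v| = deg F v.
  have sub : nbrs3 F v \subset nbrs F v by apply/subsetP => w; rewrite inE => /andP[].
  by rewrite addnC -[RHS](cardsID (nbrs3 F v) (nbrs F v)) (setIidPr sub).
rewrite leq_add2r -[X in X <= _]mul1n; apply: leq_card_separated => [w T1 T2|T TT].
  by rewrite in_setD => /andP[_]; exact: triangles_share_nbr.
have := triangle_nbrs TT; have TT' := TT.
move: TT'; rewrite inE => /andP[/trianglesP[T3 TH] vT] nT.
have /card_gt1P[u [w [uT wT uw]]] : 1 < #|T :\ v|.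
  by have := cardsD1 v T; rewrite vT T3; lia.
rewrite card_gt0; apply/set0Pn.
move: uT wT; rewrite -nT !in_setI => /andP[uT uv] /andP[wT wv].
have [du|du] := eqVneq (deg F u) 3; last first.
  by exists u; rewrite in_setI uT in_setD uv inE uv (negbTE du).
exists w; rewrite in_setI wT in_setD wv inE wv andbT /=.
by apply/negP => /eqP dw; have := light_nbrs (TH u w uT wT uw); rewrite du dw; lia.
Qed.

(** Six times the balance of v: with t triangles and j neighbours of degree 3
    it gives 3 t + 2 j, or 2 j if its degree is at most 4, and gets 6 if its
    degree is 3. Below degree k there are no neighbours of degree 3, and
    2 t <= d suffices. At degree k, adding t + j <= d twice to half of
    2 t <= d gives 3 t + 2 j <= 5 d / 2, which is at most 6 d - 24 as d >= 7. *)
Lemma vertex_charge v : 0 < deg F v ->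
  3 * ((4 < deg F v) * #|triangles_at F v|) + 2 * #|nbrs3 F v| + 24
    <= 6 * deg F v + 6 * (deg F v == 3).
Proof.
move=> dv; have t2 := double_triangles_at F v; have tj := triangles_at_nbrs3 v.
have j0 : deg F v < k -> #|nbrs3 F v| = 0.
  move=> dk; apply/eqP; rewrite -leqn0 leqNgt; apply/negP => /card_gt0P[w].
  rewrite inE => /andP[wv /eqP dw].
  by have := light_nbrs (etrans (nbrs_sym _ _ _) wv); rewrite dw; lia.
have d3 : 3 <= deg F v.
  rewrite leqNgt; apply/negP => d2; move: (dv) => /card_gt0P[w wv].
  by have := light_nbrs wv; have := degF w; move=> dw /(_ (leqW (ltnW d2))); lia.
have := degF v; have [/j0 {j0}j0|kd _] := ltnP (deg F v) k.
  by case: (ltnP 4 (deg F v)) => d4; rewrite ?mul1n ?mul0n;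
     case: (eqVneq (deg F v) 3) => d3'; lia.
have -> : 4 < deg F v by lia.
by rewrite mul1n; lia.
Qed.

(** A neighbour of a vertex of degree at most 4 has degree at least k - 1. *)
Lemma triangle_rich T : T \in triangles F -> 2 <= #|T :&: [set v | 4 < deg F v]|.
Proof.
move=> TT; have [T3 TH] := trianglesP _ _ TT.
have [sub|/subsetPn[u uT]] := boolP (T \subset [set v | 4 < deg F v]).
  by rewrite (setIidPl sub) T3.
rewrite inE -leqNgt => du.
apply: (@leq_trans #|T :\ u|); first by have := cardsD1 u T; rewrite uT T3; lia.
apply/subset_leq_card/subsetP => w; rewrite in_setD1 in_setI => /andP[wu wT].
have uw : u != w by rewrite eq_sym.
by have := light_nbrs (TH u w uT wT uw) du; rewrite wT inE; lia.
Qed.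

Lemma discharging : 4 * #|covered F| + #|triangles F| <= 2 * #|F|.
Proof.
have sum_t : 2 * #|triangles F| <= \sum_v (4 < deg F v) * #|triangles_at F v|.
  rewrite mulnC -sum_nat_const.
  apply: (@leq_trans (\sum_(T in triangles F) #|T :&: [set v | 4 < deg F v]|)).
    by apply: leq_sum => T; apply: triangle_rich.
  under eq_bigr => T _ do rewrite -sum1_card.
  under eq_bigr => T _ do under eq_bigl => v do rewrite in_setI inE.
  rewrite (exchange_big_dep predT) //=; apply: leq_sum => v _.
  case: (4 < deg F v); last by rewrite big_pred0 // => T; rewrite !andbF.
  rewrite mul1n -sum1_card; apply: eq_leq; apply: eq_bigl => T.
  by rewrite [RHS]inE andbT.
have sum_0 (f : G -> nat) : (forall v, deg F v = 0 -> f v = 0) ->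
    \sum_v f v = \sum_(v in covered F) f v.
  move=> f0; rewrite [RHS]big_mkcond; apply: eq_bigr => v _; rewrite inE.
  by case: ltnP => //; rewrite leqn0 => /eqP/f0.
have := sum_nbrs3 F; have := sum_deg F.
rewrite sum_0 // (sum_0 (fun v => #|nbrs3 F v|)); last first.
  move=> v /eqP; rewrite cards_eq0 => /eqP nv0; apply: eq_card0 => w.
  by rewrite inE nv0 in_set0.
rewrite sum_0 in sum_t; last by move=> v ->.
have : \sum_(v in covered F) (deg F v == 3) = #|[set v | deg F v == 3]|.
  rewrite -sum_0; last by move=> v ->.
  by rewrite -sum1_card [RHS]big_mkcond /=; apply: eq_bigr => v _; rewrite inE; case: eqP.
have : 3 * (\sum_(v in covered F) (4 < deg F v) * #|triangles_at F v|) +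
    2 * (\sum_(v in covered F) #|nbrs3 F v|) + #|covered F| * 24
    <= 6 * (\sum_(v in covered F) deg F v) +
       6 * (\sum_(v in covered F) (deg F v == 3)).
  rewrite !big_distrr -sum_nat_const -!big_split /=.
  by apply: leq_sum => v; rewrite inE => /vertex_charge.
move: sum_t; lia.
Qed.

End Discharging.

(** * Euler's inequality from a spanning family of cycles *)

Section CycleSpace.
Variables (G : sgraph) (F : {set edge G}).
Implicit Types (X Y z : {set edge G}) (A B : edge G).

Definition even_deg z := [forall v, ~~ odd (deg z v)].

Definition cycle_space := [set z in powerset F | even_deg z].

Definition symdiff (T : finType) (X Y : {set T}) := [set t | (t \in X) (+) (t \in Y)].

Lemma odd_symdiff (T : finType) (X Y : {set T}) :
  odd #|symdiff X Y| = odd #|X| (+) odd #|Y|.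
Proof.
have -> : symdiff X Y = (X :\: Y) :|: (Y :\: X).
  by apply/setP => t; rewrite !inE; case: (t \in X); case: (t \in Y).
rewrite cardsU (_ : _ :&: _ = set0) ?cards0 ?subn0; last first.
  by apply/setP => t; rewrite !inE; case: (t \in X); case: (t \in Y).
by rewrite -(cardsID Y X) -(cardsID X Y) setIC !oddD; do 3!case: odd.
Qed.

Lemma symdiffK (T : finType) (X Y : {set T}) : symdiff X (symdiff X Y) = Y.
Proof. by apply/setP => t; rewrite !inE addbA addbb addFb. Qed.

Lemma odd_deg_symdiff X Y v : odd (deg (symdiff X Y) v) = odd (deg X v) (+) odd (deg Y v).
Proof.
rewrite -!card_edges_at -odd_symdiff; congr (odd #|pred_of_set _|).
by apply/setP => A; rewrite !inE; case: (v \in val A); rewrite ?andbT ?andbF.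
Qed.

Lemma sub_covered X v : X \subset F -> 0 < deg X v -> v \in covered F.
Proof.
move=> XF; rewrite inE -!card_edges_at => /leq_trans; apply.
by apply/subset_leq_card/subsetP => A; rewrite !inE => /andP[/(subsetP XF) -> ->].
Qed.

(** The map sending X to its vertices of odd degree is additive, so its fibres
    are no larger than the cycle space. As the number of these vertices is
    even, one vertex may be left out of account, which gives the bound
    |F| - V + 1 on the dimension. *)
Lemma card_cycle_space : F != set0 -> 2 ^ #|F|.+1 <= #|cycle_space| * 2 ^ #|covered F|.
Proof.
case/set0Pn=> A AF.
have [v0 v0F] : exists v0, v0 \in covered F.
  have [x [y [_ eA]]] := edgeP A; exists x; rewrite inE -card_edges_at card_gt0.
  by apply/set0Pn; exists A; rewrite inE AF eA set21.
have -> : #|covered F| = #|covered F :\ v0|.+1 by rewrite (cardsD1 v0) v0F.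
rewrite !expnS mulnCA leq_pmul2l // -!card_powerset.
pose bd X := [set v in covered F :\ v0 | odd (deg X v)].
rewrite -sum1_card (partition_big bd (mem (powerset (covered F :\ v0)))) /=; last first.
  by move=> X _; rewrite powersetE; apply/subsetP => v; rewrite inE => /andP[].
rewrite mulnC -sum_nat_const; apply: leq_sum => b _; rewrite sum1dep_card.
set fib := [set X | _]; have [->|[X0]] := set_0Vmem fib; first by rewrite cards0.
rewrite inE powersetE => /andP[X0F /eqP bX0].
have inj : injective (symdiff X0) by move=> X Y /(congr1 (symdiff X0)); rewrite !symdiffK.
rewrite -(card_imset _ inj); apply/subset_leq_card/subsetP => _ /imsetP[X XP ->].
move: XP; rewrite inE powersetE => /andP[XF /eqP bX].
set z := symdiff X0 X; have zF : z \subset F.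
  apply/subsetP => B; rewrite inE.
  by have := subsetP XF B; have := subsetP X0F B; do 2!case: (_ \in _) => //=; auto.
have zv v : v != v0 -> ~~ odd (deg z v).
  move=> vv0; have [vF|] := boolP (v \in covered F); last first.
    by apply: contraNN => ov; apply: sub_covered zF _; case: (deg z v) ov.
  have : (v \in bd X0) = (v \in bd X) by rewrite bX bX0.
  rewrite !inE vv0 odd_deg_symdiff; move: vF; rewrite inE => ->.
  by move=> /= ->; rewrite addbb.
rewrite inE powersetE zF; apply/forallP => v.
have [->|/zv//] := eqVneq v v0.
have /(congr1 odd) := sum_deg z; rewrite (bigD1 v0) //= oddM oddD.
rewrite (_ : odd (\sum_(v | v != v0) _) = false) ?addbF => [->//|].
by apply: (big_ind (fun n => odd n = false)) => // [m n|w /zv/negbTE//]; rewrite oddD => -> ->.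
Qed.

(** A walk in an even subgraph can always leave a vertex by another edge than
    the one by which it arrived. *)
Lemma even_deg_next z A u v : even_deg z -> A \in z -> val A = [set u; v] -> u != v ->
  exists B w, [/\ B \in z, B != A, val B = [set v; w], v != w & u != w].
Proof.
move=> /forallP/(_ v); rewrite -card_edges_at => ev Az eA uv.
have Av : A \in edges_at z v by rewrite inE Az eA set22.
have /card_gt0P[B] : 0 < #|edges_at z v :\ A|.
  by move: ev; rewrite (cardsD1 A) Av; case: #|_|.
rewrite in_setD1 inE => /andP[BA /andP[Bz vB]].
have [w [vw eB]] := other_end vB; exists B, w; split=> //.
by apply: contraNneq BA => uw; apply/eqP/val_inj; rewrite eA eB uw setUC.
Qed.

(** Starting from an edge uv, leave both u and v by further edges; if there is no
    fourth edge, these two must meet. *)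
Lemma cycle_space_small z : z \in cycle_space -> z != set0 ->
  3 <= #|z| /\
  (#|z| = 3 -> exists2 T, T \in triangles F & z = [set A : edge G | val A \subset T]).
Proof.
rewrite inE powersetE => /andP[zF ez] /set0Pn[A Az].
have [u [v [uv eA]]] : exists u v, u != v /\ val A = [set u; v].
  have [u [v [uv eA]]] := edgeP A; exists u, v; split=> //.
  by apply: contraTneq uv => ->; rewrite adj_irr.
have [B [w [Bz BA eB vw uw]]] := even_deg_next ez Az eA uv.
have vu : v != u by rewrite eq_sym.
have eA' : val A = [set v; u] by rewrite setUC.
have [D [x [Dz DA eD ux vx]]] := even_deg_next ez Az eA' vu.
have BD : B != D.
  apply/negP => /eqP BD; have : u \in val B by rewrite BD eD set21.
  by rewrite eB !inE (negbTE uv) (negbTE uw).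
have card3 : #|[set A; B; D]| = 3.
  by rewrite -setUA !cardsU1 cards1 !inE negb_or ![A == _]eq_sym BA DA BD.
have sub3 : [set A; B; D] \subset z by rewrite !subUset !sub1set Az Bz Dz.
split=> [|z3]; first by rewrite -card3; apply: subset_leq_card.
have {sub3 card3} ez3 : z = [set A; B; D].
  by apply/esym/eqP; rewrite eqEcard sub3 card3 z3.
have [K [y [Kz KB eK wy vy]]] := even_deg_next ez Bz eB vw.
have xw : x = w.
  have : K \in [set A; B; D] by rewrite -ez3.
  have wK : w \in val K by rewrite eK set21.
  rewrite !inE (negbTE KB) orbF => /orP[]/eqP eK'; move: wK; rewrite eK'.
    by rewrite eA !inE ![w == _]eq_sym (negbTE uw) (negbTE vw).
  by rewrite eD !inE ![w == _]eq_sym (negbTE uw) => /eqP.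
subst x; exists [set u; v; w].
  apply/trianglesP; split.
    by rewrite -setUA !cardsU1 cards1 !inE negb_or uv uw vw.
  have AF := subsetP zF A Az; have BF := subsetP zF B Bz; have DF := subsetP zF D Dz.
  have Nuv : v \in nbrs F u by apply/nbrsP; exists A.
  have Nvw : w \in nbrs F v by apply/nbrsP; exists B.
  have Nuw : w \in nbrs F u by apply/nbrsP; exists D.
  have Nvu := etrans (nbrs_sym F v u) Nuv.
  have Nwv := etrans (nbrs_sym F w v) Nvw.
  have Nwu := etrans (nbrs_sym F w u) Nuw.
  move=> a b; rewrite !in_setU !in_set1 -!orbA.
  by move=> /or3P[]/eqP-> /or3P[]/eqP-> ab //; rewrite eqxx in ab.
apply/setP => K'; rewrite ez3 !inE; apply/idP/idP.
  by rewrite -orbA => /or3P[]/eqP->; rewrite ?eA ?eB ?eD subUset !sub1set !inE !eqxx ?orbT.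
have [a [b [ab eK']]] := edgeP K'.
have {}ab : a != b by apply: contraTneq ab => ->; rewrite adj_irr.
rewrite eK' subUset !sub1set !inE => /andP[aT bT].
rewrite -!(inj_eq (val_inj : injective (val : edge G -> {set G}))) eK' eA eB eD.
move: aT bT ab; rewrite -!orbA.
have Evu : [set v; u] = [set u; v] := setUC _ _.
have Ewu : [set w; u] = [set u; w] := setUC _ _.
have Ewv : [set w; v] = [set v; w] := setUC _ _.
by move=> /or3P[]/eqP-> /or3P[]/eqP->;
   rewrite ?eqxx ?orbT // => _; rewrite ?Evu ?Ewu ?Ewv ?eqxx ?orbT //.
Qed.

(** MacLane's condition gives Euler's inequality. The family S of face boundaries
    spans the cycle space, so |S| is at least its dimension. Counting the
    edges along the members of S, of size at least 4 apart from the triangles,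
    gives 4 |S| <= 2 |F| + T. *)
Lemma euler_inequality (S : {set {set edge G}}) :
    F != set0 ->
    {in S, forall s, s \in cycle_space /\ s != set0} ->
    {in F, forall A, #|[set s in S | A \in s]| <= 2} ->
    {in cycle_space, forall z, exists2 X : {set {set edge G}}, X \subset S &
       z = [set A | odd #|[set s in X | A \in s]|]} ->
  2 * #|F| + 4 <= 4 * #|covered F| + #|triangles F|.
Proof.
move=> F0 SZ S2 SX.
have ZS : #|cycle_space| <= 2 ^ #|S|.
  rewrite -card_powerset.
  apply: leq_trans (leq_imset_card
    (fun X : {set {set edge G}} => [set A | odd #|[set s in X | A \in s]|]) _).
  apply/subset_leq_card/subsetP => z /SX[X XS ->]; apply: imset_f.
  by rewrite powersetE.
have dimS : #|F|.+1 <= #|S| + #|covered F|.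
  rewrite -(leq_exp2l (m := 2)) // expnD; apply: leq_trans (card_cycle_space F0) _.
  by rewrite leq_mul2r ZS orbT.
have sumS : \sum_(s in S) #|s| <= 2 * #|F|.
  under eq_bigr => s _ do rewrite -sum1_card.
  rewrite (exchange_big_dep (mem F)) /=; last first.
    by move=> s A /SZ[]; rewrite inE powersetE => /andP[/subsetP sF _] _; apply: sF.
  rewrite mulnC -sum_nat_const; apply: leq_sum => A AF.
  by rewrite sum1dep_card S2.
have lowS : 4 * #|S| <= \sum_(s in S) #|s| + #|triangles F|.
  have tri3 : #|[set s in S | #|s| == 3]| <= #|triangles F|.
    apply: leq_trans (leq_imset_card
      (fun T : {set G} => [set A : edge G | val A \subset T]) _).
    apply/subset_leq_card/subsetP => s; rewrite inE => /andP[/SZ[sZ s0] /eqP s3].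
    have [_ /(_ s3)[T TT ->]] := cycle_space_small sZ s0; exact: imset_f.
  apply: leq_trans (leq_add (leqnn _) tri3).
  rewrite -[#|[set s in S | _]|]sum1dep_card big_mkcondr /= -big_split /=.
  rewrite mulnC -sum_nat_const; apply: leq_sum => s /SZ[sZ s0].
  have [s3 _] := cycle_space_small sZ s0.
  by case: eqP => [->|/eqP n3] //; rewrite addn0 ltn_neqAle eq_sym n3.
lia.
Qed.

End CycleSpace.

(** * Crossing parities of walks in the integer grid *)

Section Parity.

Lemma big_addb_delta (T : eqType) (s : seq T) (f : T -> bool) x : uniq s ->
  \big[addb/false]_(y <- s) (f y && (y == x)) = (x \in s) && f x.
Proof.
elim: s => [|y s IH] /=; first by rewrite big_nil.
case/andP=> ys us; rewrite big_cons IH // inE.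
case: (eqVneq y x) => [<-|yx]; first by rewrite (negbTE ys) andbT addbF.
by rewrite andbF.
Qed.

Lemma big_addb_fdelta (T : finType) (P f : pred T) x :
  \big[addb/false]_(y | P y) (f y && (y == x)) = P x && f x.
Proof.
rewrite big_mkcond /=.
rewrite (eq_bigr (fun y => (P y && f y) && (y == x))); last by move=> y _; case: (P y).
by rewrite big_addb_delta ?index_enum_uniq // mem_index_enum.
Qed.

Lemma odd_card_big (T : finType) (P : pred T) :
  odd #|[set x | P x]| = \big[addb/false]_x P x.
Proof.
rewrite -sum1dep_card (big_morph odd oddD (erefl _)) big_mkcond.
by apply: eq_bigr => x _; case: (P x).
Qed.

End Parity.

Section Grid.

Definition cell := (int * int)%type.

(** A unit edge of the integer grid: [(true, x)] goes up from the cell x, and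
    [(false, x)] goes right from it. The unit squares cut out by the grid are
    named after their lower left corners, so they have type [cell] as well;
    [side0] and [side1] are the two squares along a unit edge. *)
Definition uedge := (bool * cell)%type.

Definition end0 (e : uedge) : cell := e.2.
Definition end1 (e : uedge) : cell :=
  if e.1 then (e.2.1, e.2.2 + 1)%R else (e.2.1 + 1, e.2.2)%R.

Definition side0 (e : uedge) : cell :=
  if e.1 then (e.2.1 - 1, e.2.2)%R else (e.2.1, e.2.2 - 1)%R.
Definition side1 (e : uedge) : cell := e.2.

(** A step may stay in place, since rounding close points may give the same
    cell. *)
Definition step (x y : cell) : bool :=
  [|| x == y,
      (x.1 == y.1) && ((y.2 == x.2 + 1)%R || (x.2 == y.2 + 1)%R)
    | (x.2 == y.2) && ((y.1 == x.1 + 1)%R || (x.1 == y.1 + 1)%R)].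

Definition crosses (e : uedge) (x y : cell) : bool :=
  (x == end0 e) && (y == end1 e) || (x == end1 e) && (y == end0 e).

(** The step from x to y crosses the horizontal ray that goes right from the
    centre of the square q. *)
Definition ray (q x y : cell) : bool :=
  [&& x.1 == y.1, (q.1 < x.1)%R &
   (x.2 == q.2) && (y.2 == q.2 + 1)%R || (y.2 == q.2) && (x.2 == q.2 + 1)%R].

(** For a horizontal unit edge, the cells between the rays that start on its two
    sides. *)
Definition shadow (e : uedge) (x : cell) : bool :=
  [&& ~~ e.1, (e.2.1 < x.1)%R & x.2 == e.2.2].

(** For a vertical unit edge, the rays from its two sides differ by this edge.
    For a horizontal one, they bound a strip with the edge at its end, and a
    step crosses the boundary of the strip exactly when it enters or leaves
    the shadow. *)
Lemma ray_crosses e x y : step x y ->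
  ray (side0 e) x y (+) ray (side1 e) x y =
  crosses e x y (+) (shadow e x (+) shadow e y).
Proof.
case: e x y => [b [i j]] [x1 x2] [y1 y2]; rewrite /step xpair_eqE /=.
case/or3P=> [/andP[/eqP-> /eqP->]|/andP[/eqP-> /orP[]/eqP->]|/andP[/eqP-> /orP[]/eqP->]];
case: b; rewrite /ray /crosses /shadow /side0 /side1 /end0 /end1 !xpair_eqE /= ?eqxx /=.
all: lia.
Qed.

Lemma step_crosses x y : step x y -> x != y -> exists e, crosses e x y.
Proof.
case: x y => [x1 x2] [y1 y2]; rewrite /step !xpair_eqE /=.
case/or3P=> [/andP[/eqP-> /eqP->]|/andP[/eqP-> /orP[]/eqP->]|/andP[/eqP-> /orP[]/eqP->]].
- by rewrite !eqxx.
- move=> _; exists (true, (y1, x2)); by rewrite /crosses /end0 /end1 /= !eqxx.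
- move=> _; exists (true, (y1, y2)); by rewrite /crosses /end0 /end1 /= !eqxx orbT.
- move=> _; exists (false, (x1, y2)); by rewrite /crosses /end0 /end1 /= !eqxx.
- move=> _; exists (false, (y1, y2)); by rewrite /crosses /end0 /end1 /= !eqxx orbT.
Qed.

Lemma crosses_inj e e' x y : crosses e x y -> crosses e' x y -> e = e'.
Proof.
case: e e' x y => [b [i j]] [b' [i' j']] [x1 x2] [y1 y2].
rewrite /crosses /end0 /end1 /=; case: b; case: b'; rewrite !xpair_eqE /=.
- by move=> H H'; congr (_, (_, _)); lia.
- by move=> H H'; exfalso; lia.
- by move=> H H'; exfalso; lia.
- by move=> H H'; congr (_, (_, _)); lia.
Qed.

Definition edges_at_cell (x : cell) : seq uedge :=
  [:: (true, x); (true, (x.1, x.2 - 1)%R); (false, x); (false, (x.1 - 1, x.2)%R)].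

Lemma edges_at_cellE x e :
  \big[addb/false]_(e' <- edges_at_cell x) (e == e') = (x == end0 e) (+) (x == end1 e).
Proof.
rewrite !big_cons big_nil; case: e x => [b [i j]] [x1 x2].
by rewrite /end0 /end1 /=; case: b; rewrite !xpair_eqE /=; lia.
Qed.

(** Each of the four squares around x lies along two of the four unit edges
    at x. *)
Lemma coboundary_cell (g : cell -> bool) x :
  \big[addb/false]_(e <- edges_at_cell x) (g (side0 e) (+) g (side1 e)) = false.
Proof.
rewrite !big_cons big_nil; case: x => [x1 x2]; rewrite /side0 /side1 /=.
by case: (g _); case: (g _); case: (g _); case: (g _).
Qed.

Fixpoint walk_sum (f : cell -> cell -> bool) x p : bool :=
  if p is y :: p' then f x y (+) walk_sum f y p' else false.

Lemma walk_sum_cat f x p q : walk_sum f x (p ++ q) =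
  walk_sum f x p (+) walk_sum f (last x p) q.
Proof. by elim: p x => //= y p IH x; rewrite IH addbA. Qed.

Lemma walk_sum_eq0 f x p : {in x :: p &, forall y z, f y z = false} ->
  walk_sum f x p = false.
Proof.
elim: p x => //= y p IH x f0; rewrite f0 ?inE ?eqxx ?orbT // IH // => u v up vp.
by apply: f0; rewrite inE ?up ?vp orbT.
Qed.

Fixpoint walk_has (f : cell -> cell -> bool) x p : bool :=
  if p is y :: p' then f x y || walk_has f y p' else false.

Lemma walk_has_cat f x p q : walk_has f x (p ++ q) =
  walk_has f x p || walk_has f (last x p) q.
Proof. by elim: p x => //= y p IH x; rewrite IH orbA. Qed.

Lemma walk_sum_has0 f x p : ~~ walk_has f x p -> walk_sum f x p = false.
Proof.
by elim: p x => //= y p IH x; rewrite negb_or => /andP[/negbTE-> /IH->].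
Qed.

Lemma walk_hasP f x p : walk_has f x p ->
  exists y z, [/\ y \in x :: p, z \in x :: p & f y z].
Proof.
elim: p x => //= y p IH x /orP[fxy|/IH[u [v [up vp fuv]]]].
  by exists x, y; rewrite !inE !eqxx orbT.
by exists u, v; rewrite inE up inE vp !orbT.
Qed.

(** The steps into and out of the shadow telescope, so only the ends of the walk
    count. *)
Lemma walk_sum_ray e x p : path step x p ->
  walk_sum (ray (side0 e)) x p (+) walk_sum (ray (side1 e)) x p =
  walk_sum (crosses e) x p (+) (shadow e x (+) shadow e (last x p)).
Proof.
elim: p x => [|y p IH] x /=; first by rewrite addbb.
case/andP=> /(@ray_crosses e) xy /IH IHp; rewrite addbACA xy IHp.
by case: (crosses e x y); case: (shadow e x); case: (shadow e y);
  case: (walk_sum _ _ _); case: (shadow e (last y p)).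
Qed.

End Grid.

(** * Faces of a graph in the grid *)

Section GridModel.
Variables (G : sgraph) (F : {set edge G}).
Implicit Types (e A : edge G) (u v : G).

(** The rounded drawing. The walk of e starts at the cell of [src e], runs through
    [a e] in cells owned by [src e], steps to [mid e], and continues through
    [b e] in cells owned by [tgt e]. No two vertices own the same cell, so the
    walks of distinct edges can only meet near a common end, where they may
    overlap freely. *)
Variables (src tgt : edge G -> G) (pos : G -> cell).
Variables (a b : edge G -> seq cell) (mid : edge G -> cell) (owner : cell -> option G).

Hypothesis ends : forall e, val e = [set src e; tgt e].
Hypothesis walk_path : forall e, path step (pos (src e)) (a e ++ mid e :: b e).
Hypothesis walk_last : forall e, last (mid e) (b e) = pos (tgt e).
Hypothesis owner_src : forall e, {in pos (src e) :: a e, forall x, owner x = Some (src e)}.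
Hypothesis owner_tgt : forall e, {in mid e :: b e, forall x, owner x = Some (tgt e)}.

Let exit e := last (pos (src e)) (a e).
Let wsum e f := walk_sum f (pos (src e)) (a e ++ mid e :: b e).
Let whas e f := walk_has f (pos (src e)) (a e ++ mid e :: b e).

Lemma src_tgt e : src e != tgt e.
Proof. by have := card_edge e; rewrite ends cards2; case: eqVneq. Qed.

Lemma ends_inj e e' : src e = src e' -> tgt e = tgt e' -> e = e'.
Proof. by move=> es et; apply: val_inj; rewrite !ends es et. Qed.

Lemma ends_inj_rev e e' : src e = tgt e' -> tgt e = src e' -> e = e'.
Proof. by move=> es et; apply: val_inj; rewrite !ends es et setUC. Qed.

Lemma owner_exit e : owner (exit e) = Some (src e).
Proof. exact: (owner_src (mem_last _ _)). Qed.

Lemma owner_mid e : owner (mid e) = Some (tgt e).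
Proof. exact: (owner_tgt (mem_head _ _)). Qed.

Lemma dual_exists e : exists ep, crosses ep (exit e) (mid e).
Proof.
apply: step_crosses.
  by have := walk_path e; rewrite cat_path /= => /andP[_ /andP[]].
apply/eqP => /(congr1 owner); rewrite owner_exit owner_mid => -[E].
by have := src_tgt e; rewrite E eqxx.
Qed.

(** The unit edge by which the walk of e passes from one owner to the other. All
    other steps keep the owner, so no other walk contains it. *)
Definition gate e : uedge := xchoose (dual_exists e).

Lemma gateP e : crosses (gate e) (exit e) (mid e).
Proof. exact: (xchooseP (dual_exists e)). Qed.

Lemma crosses_owner ep x y : crosses ep x y ->
  owner (end0 ep) = owner x /\ owner (end1 ep) = owner y \/
  owner (end0 ep) = owner y /\ owner (end1 ep) = owner x.
Proof. by case/orP=> /andP[/eqP-> /eqP->]; [left|right]. Qed.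

Lemma gate_owner e x y : crosses (gate e) x y ->
  owner x = Some (src e) /\ owner y = Some (tgt e) \/
  owner x = Some (tgt e) /\ owner y = Some (src e).
Proof.
move=> /crosses_owner; have := crosses_owner (gateP e); rewrite owner_exit owner_mid.
by case=> -[-> ->] [][<- <-]; [left|right|right|left].
Qed.

Lemma gate_same_owner e x y : owner x = owner y -> crosses (gate e) x y = false.
Proof.
move=> xy; apply/negP => /gate_owner; rewrite xy.
by case=> -[-> [E]]; have := src_tgt e; rewrite E eqxx.
Qed.

Lemma crosses_gate e e' : crosses (gate e) (exit e') (mid e') = (e' == e).
Proof.
apply/idP/eqP => [/gate_owner|->]; last exact: gateP.
rewrite owner_exit owner_mid => -[][[s] [t]]; first exact: ends_inj.
exact: ends_inj_rev.
Qed.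

Lemma wsum_gate e e' : wsum e' (crosses (gate e)) = (e' == e).
Proof.
rewrite /wsum walk_sum_cat /= crosses_gate !walk_sum_eq0 ?addbF // => x y.
  by move=> /owner_tgt ox /owner_tgt oy; apply: gate_same_owner; rewrite ox oy.
by move=> /owner_src ox /owner_src oy; apply: gate_same_owner; rewrite ox oy.
Qed.

Lemma gate_inj : injective gate.
Proof.
by move=> e e' ee'; apply/eqP; rewrite -(wsum_gate e' e) -ee' wsum_gate eqxx.
Qed.

Definition used ep := [exists e in F, whas e (crosses ep)].

(** Functions on the unit squares that are constant on every face. *)
Definition face_function (g : cell -> bool) :=
  forall ep, ~~ used ep -> g (side0 ep) = g (side1 ep).

(** The parity of the winding number, around the centre of q, of the closed curve
    formed by the walks of the edges of z. *)
Definition winding (z : {set edge G}) q :=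
  \big[addb/false]_(e in z) wsum e (ray q).

(** The shadows at the ends of the walks cancel, because z has even degree at
    every vertex. *)
Lemma winding_diff z ep : z \in cycle_space F ->
  winding z (side0 ep) (+) winding z (side1 ep) =
  \big[addb/false]_(e in z) wsum e (crosses ep).
Proof.
rewrite inE powersetE => /andP[_ /forallP ez]; rewrite -big_split /=.
under eq_bigr => e _ do rewrite walk_sum_ray ?walk_path // last_cat /= walk_last.
rewrite big_split /= [X in _ (+) X](_ : _ = false) ?addbF //.
transitivity (\big[addb/false]_(e in z) \big[addb/false]_(v in val e) shadow ep (pos v)).
  apply: eq_bigr => e _; rewrite ends big_setU1 ?big_set1 //.
  by rewrite inE src_tgt.
rewrite (exchange_big_dep predT) //= big1 // => v _.
have := ez v; rewrite -card_edges_at odd_card_big /= => /negbTE ev.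
case: (shadow _ _); last by rewrite big1.
rewrite -[RHS]ev big_mkcond; apply: eq_bigr => e _ /=.
by case: (_ && _).
Qed.

Lemma winding_face z : z \in cycle_space F -> face_function (winding z).
Proof.
move=> zZ ep; rewrite negb_exists => /forallP nu.
have := winding_diff ep zZ; rewrite big1; first by do 2!case: (winding _ _).
move: (zZ); rewrite inE powersetE => /andP[/subsetP zF _] e ez.
by have := nu e; rewrite zF //= => /walk_sum_has0.
Qed.

Lemma winding_gate z e : z \in cycle_space F ->
  winding z (side0 (gate e)) (+) winding z (side1 (gate e)) = (e \in z).
Proof.
move=> zZ; rewrite winding_diff //.
under eq_bigr => e' _ do rewrite wsum_gate -[_ == _]andTb.
by rewrite (big_addb_fdelta (mem z) xpredT) andbT.
Qed.

Definition cut (g : cell -> bool) : {set edge G} :=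
  [set e in F | g (side0 (gate e)) (+) g (side1 (gate e))].

Let all_cells := flatten [seq pos (src e) :: a e ++ mid e :: b e | e <- enum F].

Lemma used_ends ep : used ep -> end0 ep \in all_cells /\ end1 ep \in all_cells.
Proof.
case/exists_inP=> e eF /walk_hasP[x [y [xw yw xy]]].
have sub z : z \in pos (src e) :: a e ++ mid e :: b e -> z \in all_cells.
  by move=> zw; apply/flatten_mapP; exists e; rewrite ?mem_enum.
by case/orP: xy => /andP[/eqP<- /eqP<-]; split; apply: sub.
Qed.

(** A unit edge of a walk leaves the cells owned by u exactly when it is the gate
    of an edge at u. *)
Lemma used_owner ep u : used ep ->
  (owner (end0 ep) == Some u) (+) (owner (end1 ep) == Some u) =
  \big[addb/false]_(e in edges_at F u) (ep == gate e).
Proof.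
case/exists_inP=> e' e'F; rewrite /whas walk_has_cat /= => /or3P[].
- case/walk_hasP=> x [y [/owner_src ox /owner_src oy xy]].
  rewrite big1 => [|e _]; last first.
    apply/negP => /eqP epe; move: xy; rewrite epe gate_same_owner //.
    by rewrite ox oy.
  by have [[-> ->]|[-> ->]] := crosses_owner xy; rewrite ox oy addbb.
- move=> xy; have -> : ep = gate e' by apply: crosses_inj xy (gateP e').
  under eq_bigr => e _ do rewrite (inj_eq gate_inj) eq_sym -[_ == _]andTb.
  rewrite (big_addb_fdelta (mem (edges_at F u)) xpredT) /= andbT inE e'F /= ends !inE.
  have /negP nst : ~~ ((src e' == u) && (tgt e' == u)).
    by apply/negP => /andP[/eqP eu]; rewrite -eu eq_sym (negbTE (src_tgt e')).
  have := crosses_owner (gateP e'); rewrite owner_exit owner_mid.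
  case=> -[-> ->]; rewrite !(inj_eq Some_inj) ![u == _]eq_sym;
  by move: nst; case: (src e' == u); case: (tgt e' == u) => // -[].
- case/walk_hasP=> x [y [/owner_tgt ox /owner_tgt oy xy]].
  rewrite big1 => [|e _]; last first.
    apply/negP => /eqP epe; move: xy; rewrite epe gate_same_owner //.
    by rewrite ox oy.
  by have [[-> ->]|[-> ->]] := crosses_owner xy; rewrite ox oy addbb.
Qed.

Lemma used_gate e : e \in F -> used (gate e).
Proof.
move=> eF; apply/exists_inP; exists e => //.
by rewrite /whas walk_has_cat /= gateP orbT.
Qed.

(** Call a unit edge bright if g differs on its sides. Every cell is on an even
    number of bright edges by [coboundary_cell]. Summing over the cells owned by
    u, only the bright edges that leave these cells remain. As they lie on
    walks, they are the bright gates of the edges at u. *)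
Lemma cut_cycle g : face_function g -> cut g \in cycle_space F.
Proof.
move=> gF; rewrite inE powersetE; apply/andP; split.
  by apply/subsetP => e; rewrite inE => /andP[].
apply/forallP => u; rewrite -card_edges_at odd_card_big.
pose D ep := g (side0 ep) (+) g (side1 ep).
pose Ed := undup [seq ep <- flatten (map edges_at_cell all_cells) | used ep].
have Du ep : ~~ used ep -> D ep = false by move/gF; rewrite /D => ->; rewrite addbb.
have EdE ep : (ep \in Ed) = used ep.
  rewrite mem_undup mem_filter; case: (boolP (used ep)) => //= /used_ends[e0 _].
  apply/flatten_mapP; exists (end0 ep) => //; case: ep e0 => [[] [i j]] _;
  by rewrite /end0 !inE eqxx ?orbT.
have uEd : uniq Ed by apply: undup_uniq.
pose X := undup [seq x <- all_cells | owner x == Some u].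
have XE ep x : used ep -> (x == end0 ep) || (x == end1 ep) ->
    (x \in X) = (owner x == Some u).
  move=> /used_ends[e0 e1] ex; rewrite mem_undup mem_filter.
  by case/orP: ex => /eqP->; rewrite ?e0 ?e1 andbT.
have Dsum x : \big[addb/false]_(ep <- Ed)
    (D ep && ((x == end0 ep) (+) (x == end1 ep))) = false.
  rewrite -[RHS](coboundary_cell g x).
  under eq_bigr => ep _ do rewrite -edges_at_cellE big_distrr /=.
  rewrite exchange_big /=; apply: eq_bigr => ep _.
  rewrite big_addb_delta // EdE.
  by case: (boolP (used ep)) => //= /Du; rewrite /D => ->.
have : \big[addb/false]_(x <- X) \big[addb/false]_(ep <- Ed)
    (D ep && ((x == end0 ep) (+) (x == end1 ep))) = false.
  by rewrite big1.
rewrite exchange_big /= => {}Dsum.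
have {}Dsum : \big[addb/false]_(e in edges_at F u) D (gate e) = false.
  rewrite -[RHS]Dsum; symmetry.
  transitivity (\big[addb/false]_(ep <- Ed)
      \big[addb/false]_(e in edges_at F u) (D ep && (ep == gate e))).
    apply: eq_big_seq => ep; rewrite EdE => uep.
    rewrite -!big_distrr /= -used_owner // big_split /=; congr (_ && _).
    have ux : uniq X by apply: undup_uniq.
    have big_delta y : \big[addb/false]_(x <- X) (x == y) = (y \in X).
      under eq_bigr => x _ do rewrite -[_ == _]andTb.
      by rewrite (big_addb_delta xpredT) // andbT.
    by rewrite !big_delta !(XE ep) ?eqxx ?orbT.
  rewrite exchange_big /=; apply: eq_bigr => e; rewrite inE => /andP[eF _].
  by rewrite big_addb_delta // EdE used_gate.
rewrite -[\big[_/_]_x _]addbF -[X in _ (+) X]Dsum [X in _ (+) X]big_mkcond -big_split /=.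
rewrite big1 // => e _; rewrite !inE -/(D _).
by case: (e \in F) => //=; rewrite ?andbF; case: (u \in sval e); rewrite ?andbT ?andbF ?addbb.
Qed.

Definition edge_side (t : edge G * bool) : cell :=
  if t.2 then side1 (gate t.1) else side0 (gate t.1).

(** Faces are defined through the functions constant on them, so that the
    indicator function of a face is such a function by construction. *)
Definition same_face (q r : cell) : bool :=
  `[< forall g, face_function g -> g q = g r >].

Lemma same_faceP q r :
  reflect (forall g, face_function g -> g q = g r) (same_face q r).
Proof. exact: asboolP. Qed.

Lemma same_face_refl q : same_face q q.
Proof. exact/same_faceP. Qed.

Lemma same_face_eql q r : same_face q r -> same_face q =1 same_face r.
Proof.
move=> /same_faceP qr s; apply/same_faceP/same_faceP => H g gF.
  by rewrite -qr ?H.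
by rewrite qr ?H.
Qed.

Lemma face_function_same q : face_function (same_face q).
Proof.
move=> ep nu; apply/same_faceP/same_faceP => H g gF; rewrite H //.
  exact: gF.
exact/esym/gF.
Qed.

(** Only the faces along gates matter. They are represented by the sides of
    gates, [(e, false)] or [(e, true)], and [face_rep] selects one side for
    each of them. *)
Definition face_rep t : edge G * bool :=
  odflt t [pick t' | same_face (edge_side t) (edge_side t')].

Lemma face_repP t : same_face (edge_side t) (edge_side (face_rep t)).
Proof. by rewrite /face_rep; case: pickP => [//|_]; apply: same_face_refl. Qed.

Lemma face_rep_eq t t' : same_face (edge_side t) (edge_side t') ->
  face_rep t = face_rep t'.
Proof.
move=> tt'; rewrite /face_rep (eq_pick (fun s => same_face_eql tt' (edge_side s))).
case: pickP => // /(_ t'); by rewrite same_face_refl.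
Qed.

Definition boundary t := cut (same_face (edge_side t)).

Definition faces := [set t | face_rep t == t].

Definition boundaries := (boundary @: faces) :\ set0.

Lemma boundaries_cycle : {in boundaries, forall s, s \in cycle_space F /\ s != set0}.
Proof.
move=> s; rewrite in_setD1 => /andP[s0 /imsetP[t _ es]]; split=> //.
by rewrite es; apply/cut_cycle/face_function_same.
Qed.

(** The gate of A has two sides, and the face of a boundary through A contains
    one of them. *)
Lemma boundaries_le2 A : #|[set s in boundaries | A \in s]| <= 2.
Proof.
pose s2 := [set boundary (face_rep (A, false)); boundary (face_rep (A, true))].
apply: (@leq_trans #|s2|); last by rewrite cards2; case: (_ != _).
apply/subset_leq_card/subsetP => s; rewrite inE in_setD1 => /andP[/andP[_]].
case/imsetP=> t; rewrite inE => /eqP et -> {s}; rewrite inE => /andP[_ As].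
have : same_face (edge_side t) (edge_side (A, false)) \/
       same_face (edge_side t) (edge_side (A, true)).
  by move: As; rewrite /edge_side /=; case: (same_face _ _); [left|right].
by case=> /face_rep_eq; rewrite et => ->; rewrite !inE eqxx ?orbT.
Qed.

Lemma face_expand g t : face_function g ->
  g (edge_side t) = \big[addb/false]_(f in faces)
    (g (edge_side f) && same_face (edge_side f) (edge_side t)).
Proof.
move=> gF; transitivity
  (\big[addb/false]_(f in faces) (g (edge_side f) && (f == face_rep t))).
  rewrite (big_addb_fdelta (mem faces) (fun f => g (edge_side f))) /=.
  have tt := face_repP t.
  by rewrite -((same_faceP _ _ tt) g gF) inE -(face_rep_eq tt) eqxx.
apply: eq_bigr => f; rewrite inE => /eqP ef; congr (_ && _).
apply/eqP/idP => [->|/face_rep_eq <-//].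
by rewrite -(same_face_eql (face_repP t)) same_face_refl.
Qed.

(** The cycle z is the sum of the boundaries of the faces on which its winding
    function is true. Distinct faces may have the same boundary, so each
    boundary s is taken with the parity of the number of these faces. *)
Lemma boundaries_span : {in cycle_space F, forall z,
  exists2 X : {set {set edge G}}, X \subset boundaries &
    z = [set A | odd #|[set s in X | A \in s]|]}.
Proof.
move=> z zZ; pose g := winding z; have gF := winding_face zZ.
pose X := [set s in boundaries |
  \big[addb/false]_(f in faces) (g (edge_side f) && (boundary f == s))].
exists X; first by apply/subsetP => s; rewrite inE => /andP[].
apply/setP => A; rewrite [RHS]inE odd_card_big.
transitivity (\big[addb/false]_(f in faces) (g (edge_side f) && (A \in boundary f))).
  case: (boolP (A \in F)) => AF; last first.
    rewrite big1 => [|f _]; last by rewrite [A \in _]inE (negbTE AF) andbF.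
    move: zZ; rewrite inE powersetE => /andP[/subsetP zF _].
    by apply/negbTE; apply: contraNN AF; apply: zF.
  rewrite -winding_gate // (face_expand (A, false) gF) (face_expand (A, true) gF).
  rewrite -big_split; apply: eq_bigr => f _ /=.
  by rewrite -andb_addr; congr (_ && _); rewrite inE AF.
transitivity (\big[addb/false]_(f in faces) \big[addb/false]_(s in boundaries)
    ((g (edge_side f) && (A \in s)) && (s == boundary f))).
  apply: eq_bigr => f fF.
  rewrite (big_addb_fdelta (mem boundaries) (fun s => g (edge_side f) && (A \in s))) /=.
  rewrite in_setD1 imset_f // andbT.
  by case: eqP => // ->; rewrite in_set0 andbF.
rewrite exchange_big /= big_mkcond /=; apply: eq_bigr => s _.
rewrite [s \in X]inE; case: (s \in boundaries) => //=.
rewrite big_distrl /=; apply: eq_bigr => f _.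
by rewrite eq_sym; case: (g _); case: (A \in s); case: (_ == _).
Qed.

Lemma grid_model_euler : F != set0 ->
  2 * #|F| + 4 <= 4 * #|covered F| + #|triangles F|.
Proof.
move=> F0; apply: (euler_inequality F0 boundaries_cycle _ boundaries_span).
by move=> A _; apply: boundaries_le2.
Qed.

End GridModel.

Import Order.TTheory GRing.Theory Num.Theory numFieldNormedType.Exports.

(** * Compactness of arcs *)

Section Compactness.
Local Open Scope classical_set_scope.
Local Open Scope ring_scope.
Variable R : realType.

Lemma compact_pos_bound (T : topologicalType) (K : set T) (f : T -> R) :
  compact K -> continuous f -> (forall x, K x -> 0 < f x) ->
  exists2 d, 0 < d & forall x, K x -> d <= f x.
Proof.
move=> cK cf f0.
have [->|/classical_sets.set0P K0] := eqVneq K classical_sets.set0; first by exists 1.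
have [c cK' cmin] := compact_EVT_min K0 cK (continuous_subspaceT cf).
exists (f c); first exact/f0/set_mem.
by move=> x Kx; apply/cmin/mem_set.
Qed.

(** An arc is only assumed to be continuous on the unit interval; composing it
    with [unit_clamp] makes it continuous on the whole line. *)
Definition unit_clamp (t : R) : R := Num.max 0 (Num.min t 1).

Lemma unit_clamp_itv t : unit_clamp t \in `[0, 1].
Proof. by rewrite in_itv /= /unit_clamp le_max lexx ge_max ler01 ge_min lexx orbT. Qed.

Lemma unit_clamp_id t : t \in `[0, 1] -> unit_clamp t = t.
Proof. by rewrite in_itv /= /unit_clamp => /andP[t0 t1]; rewrite min_l // max_r. Qed.

Lemma unit_clamp_continuous : continuous unit_clamp.
Proof.
move=> t; apply: (@continuous_max R R (fun=> 0) (id \min (fun=> 1))).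
  exact: cst_continuous.
apply: (@continuous_min R R id (fun=> 1)); last exact: cst_continuous.
by move=> U.
Qed.

Lemma continuous_clamped (V : topologicalType) (f : R -> V) :
  {within `[0, 1], continuous f} -> continuous (f \o unit_clamp).
Proof.
move=> /subspace_continuousP cf t.
have ct := unit_clamp_itv t.
apply: (@cvg_comp _ _ _ _ _ _ (within `[0%R, 1%R] (nbhs (unit_clamp t)))); last exact: cf.
move=> U /(@unit_clamp_continuous t) HU; change (nbhs t (unit_clamp @^-1` U)).
by apply: (@filterS _ (nbhs t) _ _ _ _ HU) => s; apply; apply: unit_clamp_itv.
Qed.

(** The maximum distance, since rounding acts on the coordinates separately. *)
Definition pdist (x y : R * R) : R := Num.max `|x.1 - y.1| `|x.2 - y.2|.

Lemma pdist_lt x y e : (pdist x y < e) = (`|x.1 - y.1| < e) && (`|x.2 - y.2| < e).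
Proof. exact: gt_max. Qed.

Lemma pdistC x y : pdist x y = pdist y x.
Proof. by rewrite /pdist (distrC x.1) (distrC x.2). Qed.

Lemma pdist_triangle y x z : pdist x z <= pdist x y + pdist y z.
Proof.
rewrite {1}/pdist ge_max; apply/andP; split.
  by apply: (le_trans (ler_distD y.1 _ _)); apply: lerD; rewrite /pdist le_max lexx.
by apply: (le_trans (ler_distD y.2 _ _)); apply: lerD; rewrite /pdist le_max lexx orbT.
Qed.

Lemma pdist_gt0 x y : (0 < pdist x y) = (x != y).
Proof.
rewrite lt_max !normr_gt0 !subr_eq0; case: x y => [x1 x2] [y1 y2] /=.
by rewrite xpair_eqE negb_and.
Qed.

Lemma pdist_continuous (T : topologicalType) (f g : T -> R * R) :
  continuous f -> continuous g -> continuous (fun t => pdist (f t) (g t)).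
Proof.
move=> cf cg t.
have cdist (h : R * R -> R) : continuous h ->
    {for t, continuous (fun t => `|h (f t) - h (g t)| : R)}.
  move=> ch; apply: (@continuous_comp _ _ _ (fun t => h (f t) - h (g t)) Num.norm);
    last exact: norm_continuous.
  by apply: (@continuousB _ R); apply: (@continuous_comp _ _ _ _ h);
    by [exact: cf|exact: cg|exact: ch].
apply: (@continuous_max R T (fun t => `|(f t).1 - (g t).1|) (fun t => `|(f t).2 - (g t).2|)).
  by apply: (cdist fst) => x; exact: cvg_fst.
by apply: (cdist snd) => x; exact: cvg_snd.
Qed.

Lemma separated_arcs (f g : R -> R * R) (a b c d : R) : continuous f -> continuous g ->
  {in `[a, b] & `[c, d], forall s t, f s <> g t} ->
  exists2 e, 0 < e & {in `[a, b] & `[c, d], forall s t, e <= pdist (f s) (g t)}.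
Proof.
move=> cf cg fg.
have cK := compact_setX (@segment_compact _ a b) (@segment_compact _ c d).
have cd : continuous (fun st : R * R => pdist (f st.1) (g st.2)).
  apply: pdist_continuous => st.
    by apply: (@continuous_comp _ _ _ fst f); [exact: cvg_fst|exact: cf].
  by apply: (@continuous_comp _ _ _ snd g); [exact: cvg_snd|exact: cg].
have [|e e0 H] := compact_pos_bound cK cd.
  by move=> [s t] [/= sab tcd]; rewrite pdist_gt0; apply/eqP/fg.
by exists e => // s t sab tcd; apply: (H (s, t)).
Qed.

(** On the compact set of pairs (s, t) whose images are at distance at least e,
    the positive function |s - t| has a positive lower bound. *)
Lemma uniformly_continuous_arc (f : R -> R * R) (e : R) : continuous f -> 0 < e ->
  exists2 d, 0 < d &
    {in `[0, 1] &, forall s t, `|s - t| < d -> pdist (f s) (f t) < e}.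
Proof.
move=> cf e0.
have cd : continuous (fun st : R * R => pdist (f st.1) (f st.2)).
  apply: pdist_continuous => st.
    by apply: (@continuous_comp _ _ _ fst f); [exact: cvg_fst|exact: cf].
  by apply: (@continuous_comp _ _ _ snd f); [exact: cvg_snd|exact: cf].
pose K := (`[0, 1] `*` `[0, 1]) `&`
  ((fun st : R * R => pdist (f st.1) (f st.2)) @^-1` [set x | e <= x]).
have cK : compact K.
  apply: compact_closedI; first exact/compact_setX/segment_compact/segment_compact.
  by apply: preimage_closed; [move=> st _; exact: cd|exact: closed_ge].
have cid : continuous (fun st : R * R => `|st.1 - st.2| : R).
  move=> st; apply: (@continuous_comp _ _ _ (fun st : R * R => st.1 - st.2) Num.norm);
    last exact: norm_continuous.
  by apply: (@continuousB _ R); [exact: cvg_fst|exact: cvg_snd].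
have [|d d0 H] := compact_pos_bound cK cid.
  move=> [s t] [_ /= est]; rewrite normr_gt0 subr_eq0; apply/negP => /eqP st.
  by move: est; rewrite st leNgt => /negP; apply; rewrite /pdist !subrr normr0 maxxx.
exists d => // s t s01 t01; rewrite !ltNge; apply: contraNN => est.
exact: (H (s, t)).
Qed.

End Compactness.

(** * From arcs to grid walks *)

Section Rounding.
Local Open Scope ring_scope.
Variables (R : realType) (h : R).
Hypothesis h0 : 0 < h.

Definition cell_of (x : R * R) : cell := (Num.floor (x.1 / h), Num.floor (x.2 / h)).

Lemma floor_close (x y : R) : `|x - y| < h ->
  `|Num.floor (x / h) - Num.floor (y / h)| <= 1.
Proof.
move=> xy; have {}xy : `|x / h - y / h| < 1.
  by rewrite -mulrBl normrM (gtr0_norm (x := h^-1)) ?invr_gt0 // ltr_pdivrMr // mul1r.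
have /andP[x0 x1] := floor_itv (x / h); have /andP[y0 y1] := floor_itv (y / h).
move: xy; rewrite ltr_norml => /andP[xy yx].
move: x1 y1; rewrite !intrD => x1 y1.
have ab : Num.floor (x / h) < Num.floor (y / h) + 2.
  by rewrite -(ltr_int R) intrD; move: x0 y1 yx; lra.
have ba : Num.floor (y / h) < Num.floor (x / h) + 2.
  by rewrite -(ltr_int R) intrD; move: y0 x1 xy; lra.
by rewrite ler_norml; move: ab ba; lia.
Qed.

Lemma floor_eq_close (x y : R) : Num.floor (x / h) = Num.floor (y / h) -> `|x - y| < h.
Proof.
move=> xy; suff: `|x / h - y / h| < 1.
  by rewrite -mulrBl normrM (gtr0_norm (x := h^-1)) ?invr_gt0 // ltr_pdivrMr // mul1r.
have /andP[x0 x1] := floor_itv (x / h); have /andP[y0 y1] := floor_itv (y / h).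
move: x1 y1; rewrite !intrD xy in x0 * => x1 y1.
by rewrite ltr_norml; apply/andP; split; lra.
Qed.

Lemma cell_of_eq x y : cell_of x = cell_of y -> pdist x y < h.
Proof. by case=> /floor_eq_close e1 /floor_eq_close e2; rewrite pdist_lt e1. Qed.

(** The walks below also use cells that contain no point of the arc, namely
    corners between two cells that touch diagonally; these are rounded from
    points at distance less than h from the arc. *)
Definition near_cell (c : R * R) (z : cell) := exists2 x, pdist x c < h & z = cell_of x.

Lemma near_cell_of c : near_cell c (cell_of c).
Proof. by exists c; rewrite // /pdist !subrr normr0 maxxx. Qed.

Lemma near_cell_dist c c' z : near_cell c z -> near_cell c' z -> pdist c c' < h *+ 3.
Proof.
move=> [x xc zx] [y yc' zy]; have xy : pdist x y < h by apply: cell_of_eq; rewrite -zx.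
apply: le_lt_trans (pdist_triangle x c c') _; rewrite pdistC mulrS ltrD //.
by apply: le_lt_trans (pdist_triangle y x c') _; rewrite mulr2n ltrD.
Qed.

(** Change one coordinate after the other. *)
Lemma step_close c c' : pdist c c' < h -> exists m,
  [/\ step (cell_of c) m, step m (cell_of c') & near_cell c m].
Proof.
rewrite pdist_lt => /andP[c1 c2]; exists (Num.floor (c'.1 / h), Num.floor (c.2 / h)).
split.
- have := floor_close c1; rewrite /step xpair_eqE /= eqxx ler_norml.
  by move: (Num.floor _) (Num.floor _) => i j; lia.
- have := floor_close c2; rewrite /step xpair_eqE /= eqxx ler_norml.
  by move: (Num.floor (c.2 / h)) (Num.floor (c'.2 / h)) => i j; lia.
- by exists (c'.1, c.2); rewrite // pdist_lt /= subrr normr0 h0 distrC c1.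
Qed.

Lemma grid_walk (c : nat -> R * R) k :
  (forall i, (i < k)%N -> pdist (c i) (c i.+1) < h) ->
  exists p : seq cell, [/\ path step (cell_of (c 0%N)) p,
      last (cell_of (c 0%N)) p = cell_of (c k)
    & {in cell_of (c 0%N) :: p, forall z, exists2 i, (i <= k)%N & near_cell (c i) z}].
Proof.
elim: k => [|k IH] ck.
  exists [::]; split=> // z; rewrite inE => /eqP->; exists 0%N => //.
  exact: near_cell_of.
have [i ik|p [pp lp np]] := IH; first by apply: ck; apply: leqW.
have [m [cm mc nm]] := step_close (ck k (leqnn _)).
exists (p ++ [:: m; cell_of (c k.+1)]); split.
- by rewrite cat_path pp lp /= cm mc.
- by rewrite last_cat.
- move=> z; rewrite -cat_cons mem_cat => /orP[/np[i ik nz]|].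
    by exists i => //; apply: leqW.
  rewrite !inE => /orP[]/eqP->; first by exists k.
  by exists k.+1 => //; apply: near_cell_of.
Qed.

End Rounding.

(** Let the walk q start on the walk p and end off it. Cut q after its last visit
    to p, and reach the cell of that visit along p instead: the result is a
    walk along p followed by a walk that avoids p. *)
Lemma split_walk (T : eqType) (r : rel T) x p s q : path r x p -> s \in x :: p ->
  path r s q -> last s q \notin x :: p ->
  exists p' m b, [/\ path r x (p' ++ m :: b), last m b = last s q,
    {subset x :: p' <= x :: p}, {subset m :: b <= q} &
    {in m :: b, forall z, z \notin x :: p}].
Proof.
move=> xp; have [n] := ubnP (size q); elim: n s q => // n IH s q sq sp sq_path lq.
have [/hasP[z zq zp]|/hasPn nq] := boolP (has (mem (x :: p)) q).
  have [q1 [q2 eq]] : exists q1 q2, q = q1 ++ z :: q2.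
    by case/splitPr: zq => q1 q2; exists q1, q2.
  move: sq sq_path lq; rewrite eq size_cat /= cat_path last_cat /=.
  move=> sq /and3P[_ _ zq2] lq.
  have [|p' [m [b [pp lb sub1 sub2 dis]]]] := IH z q2 _ zp zq2 lq; first by lia.
  by exists p', m, b; split=> // y /sub2 yq2; rewrite mem_cat inE yq2 !orbT.
case: q sq_path lq nq {sq} => [|w q] sq lq nq; first by rewrite /= sp in lq.
have [p1 [p2 [ep es]]] : exists p1 p2, p = p1 ++ p2 /\ s = last x p1.
  by case/splitPl: sp => p1 p2 es; exists p1, p2.
subst p s; exists p1, w, q; split=> //.
- by rewrite cat_path; move: xp sq; rewrite cat_path => /andP[-> _].
- by move=> z; rewrite -cat_cons mem_cat => ->.
Qed.

(** * From drawings to colourings *)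

Section Drawings.
Local Open Scope ring_scope.
Variable R : realType.

Lemma common_pos_bound (I : finType) (Q : I -> R -> Prop) :
  (forall i d d', d' <= d -> Q i d -> Q i d') ->
  (forall i, exists2 d, 0 < d & Q i d) -> exists2 d, 0 < d & forall i, Q i d.
Proof.
move=> Qle exQ; suff [d d0 Qd] : exists2 d, 0 < d & {in enum I, forall i, Q i d}.
  by exists d => // i; apply: Qd; rewrite mem_enum.
elim: (enum I) => [|i s [d d0 Qd]]; first by exists 1.
have [d' d0' Qd'] := exQ i; exists (Num.min d d'); first by rewrite lt_min d0.
move=> j; rewrite inE => /orP[/eqP->|/Qd Qjd].
  by apply: Qle Qd'; rewrite ge_min lexx orbT.
by apply: Qle Qjd; rewrite ge_min lexx.
Qed.

(** Cut every arc in the middle. Halves of distinct arcs that belong to distinct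
    vertices are disjoint compact sets, so there is a lower bound 3 h for all
    their distances, and also for the distances from a first half to the far end
    of its arc. Rounding to a grid of width h thus keeps them apart. The two
    halves of one arc meet in the middle, and [split_walk] separates their
    cells. *)
Lemma planar_euler (G : sgraph) (F : {set edge G}) : planar R G -> F != set0 ->
  (2 * #|F| + 4 <= 4 * #|covered F| + #|triangles F|)%N.
Proof.
case=> p [f [p_inj f_arc f_vertex f_edge]] F0.
have /boolp.choice[st stP] : forall e, exists xy : G * G,
    [/\ val e = [set xy.1; xy.2], f e 0 = p xy.1 & f e 1 = p xy.2].
  by move=> e; have [_ _ [x [y H]]] := f_arc e; exists (x, y).
pose src e := (st e).1; pose tgt e := (st e).2.
pose g e := f e \o @unit_clamp R.
have g_cont e : continuous (g e) by apply: continuous_clamped; have [] := f_arc e.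
have gE e s : s \in `[0, 1] -> g e s = f e s by move=> s01; rewrite /g /= unit_clamp_id.
have i0 : (0 : R) \in `[0, 1] by rewrite in_itv /= lexx ler01.
have i1 : (1 : R) \in `[0, 1] by rewrite in_itv /= lexx ler01.
have g0 e : g e 0 = p (src e) by rewrite gE //; have [] := stP e.
have g1 e : g e 1 = p (tgt e) by rewrite gE //; have [] := stP e.
have g_inj e : {in `[0, 1] &, injective (g e)}.
  by move=> s t s01 t01; rewrite !gE //; have [_ f_inj _] := f_arc e; exact: f_inj.
pose hown (t : edge G * bool) := if t.2 then tgt t.1 else src t.1.
pose half (b : bool) : interval R := if b then `[2^-1, 1] else `[0, 2^-1].
have half01 b s : s \in half b -> s \in `[0, 1].
  by case: b; rewrite !in_itv /=; lra.
(* Within its half, an arc reaches only the vertex that owns the half. *)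
have half_end t s : s \in half t.2 -> (s \in `]0, 1[) \/ g t.1 s = p (hown t).
  case: t => e [] /=; rewrite in_itv /= /hown /= => /andP[s0 s1].
    have [->|s1'] := eqVneq s 1; first by right.
    by left; rewrite in_itv /=; move: s1'; rewrite neq_lt; lra.
  have [->|s0'] := eqVneq s 0; first by right.
  by left; rewrite in_itv /=; move: s0'; rewrite neq_lt; lra.
have itvW (s : R) : (s \in `]0, 1[) -> s \in `[0, 1].
  by rewrite !in_itv /=; lra.
have disj t t' : t.1 != t'.1 -> hown t != hown t' ->
    {in half t.2 & half t'.2, forall s s', g t.1 s <> g t'.1 s'}.
  move=> tt' ht s s' /half_end hs /half_end hs'.
  case: hs => [js|->]; case: hs' => [js'|->].
  - by rewrite !gE ?itvW //; apply: f_edge.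
  - by rewrite gE ?itvW //; apply: f_vertex.
  - by rewrite gE ?itvW // => E; apply: (f_vertex t'.1 (hown t) s').
  - by move=> /p_inj E; rewrite E eqxx in ht.
have [d1 d1_gt0 sep1] : exists2 d, 0 < d & forall tt : (edge G * bool) * (edge G * bool),
    tt.1.1 != tt.2.1 -> hown tt.1 != hown tt.2 ->
    {in half tt.1.2 & half tt.2.2, forall s s', d <= pdist (g tt.1.1 s) (g tt.2.1 s')}.
  apply: common_pos_bound => [tt d d' dd' H n1 n2 s s' hs hs'|[t t'] /=].
    exact: le_trans dd' (H n1 n2 s s' hs hs').
  have [n1|] := boolP (t.1 != t'.1); last by exists 1.
  have [n2|] := boolP (hown t != hown t'); last by exists 1.
  have := disj t t' n1 n2; rewrite /half; case: t.2; case: t'.2 => H;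
  by have [d d0 Hd] := separated_arcs (g_cont t.1) (g_cont t'.1) H; exists d.
have [d2 d2_gt0 sep2] : exists2 d, 0 < d & forall e,
    {in half false, forall s, d <= pdist (g e s) (p (tgt e))}.
  apply: common_pos_bound => [e d d' dd' H s hs|e]; first exact: le_trans dd' (H s hs).
  have H : {in `[0, 2^-1] & `[1, 1], forall s t, g e s <> g e t}.
    move=> s t hs; rewrite in_itv /= => /andP[t1 t1'].
    have -> : t = 1 by apply/le_anti; rewrite t1 t1'.
    move=> /(g_inj e s 1 (half01 false s hs) i1) s1.
    by move: hs; rewrite s1 in_itv /=; lra.
  have [d d0 Hd] := separated_arcs (g_cont e) (g_cont e) H; exists d => // s hs.
  by rewrite -g1; apply: Hd => //; rewrite in_itv /= lexx.
pose h := Num.min d1 d2 / 3.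
have h0 : 0 < h by rewrite divr_gt0 // lt_min d1_gt0.
have h3 : h *+ 3 = Num.min d1 d2 by rewrite -mulr_natr /h divfK // pnatr_eq0.
have [eta eta0 unif] : exists2 d, 0 < d & forall e,
    {in `[0, 1] &, forall s t, `|s - t| < d -> pdist (g e s) (g e t) < h}.
  apply: common_pos_bound => [e d d' dd' H s t hs ht st'|e].
    by apply: H => //; apply: lt_le_trans dd'.
  exact: uniformly_continuous_arc.
(* There are 2 n + 1 sample times, the middle one being tau n = 1/2. *)
pose n := (Num.bound eta^-1).+1.
pose tau (i : nat) : R := i%:R / (n + n)%:R.
have nn0 : 0 < (n + n)%:R :> R by rewrite ltr0n addn_gt0.
have tau_half i : (i <= n)%N -> tau i \in half false.
  move=> ile; rewrite in_itv /= divr_ge0 ?ler0n //= ler_pdivrMr // natrD.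
  have : (i%:R <= n%:R :> R) by rewrite ler_nat.
  by lra.
have tau_half' i : (i <= n)%N -> tau (n + i)%N \in half true.
  move=> ile; rewrite in_itv /= ler_pdivrMr // ler_pdivlMr // !natrD.
  have : (i%:R <= n%:R :> R) by rewrite ler_nat.
  have : (0 <= i%:R :> R) by rewrite ler0n.
  by lra.
have tau_step i : `|tau i - tau i.+1| < eta.
  rewrite distrC -mulrBl -natrB // subSnn mul1r gtr0_norm ?invr_gt0 //.
  rewrite invf_plt ?posrE //; apply: lt_le_trans (archi_boundP _) _.
    by rewrite invr_ge0 ltW.
  by rewrite ler_nat /n addSn ltnW // ltnS leq_addr.
have close1 e i : (i < n)%N -> pdist (g e (tau i)) (g e (tau i.+1)) < h.
  move=> ile; apply: unif; rewrite ?tau_step //; apply: (half01 false); apply: tau_half => //.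
  exact: ltnW.
have close2 e i : (i < n)%N -> pdist (g e (tau (n + i)%N)) (g e (tau (n + i.+1)%N)) < h.
  move=> ile; rewrite addnS; apply: unif; rewrite ?tau_step //; apply: (half01 true).
    exact/tau_half'/ltnW.
  by rewrite -addnS; apply: tau_half'.
have tau0 : tau 0 = 0 by rewrite /tau mul0r.
have taunn : tau (n + n)%N = 1 by rewrite /tau divff // gt_eqF.
pose pos u := cell_of h (p u).
have /boolp.choice[w wP] : forall e, exists w : seq cell * cell * seq cell,
  let: (a, mid, b) := w in
  [/\ path step (pos (src e)) (a ++ mid :: b), last mid b = pos (tgt e),
      {in pos (src e) :: a, forall z, exists2 s, s \in half false & near_cell h (g e s) z},
      {in mid :: b, forall z, exists2 s, s \in half true & near_cell h (g e s) z} &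
      {in mid :: b, forall z, z \notin pos (src e) :: a}].
  move=> e.
  have [a0 [pa la na]] := grid_walk h0 (close1 e).
  have [b0 [pb lb nb]] := grid_walk h0 (close2 e).
  rewrite tau0 g0 in pa la na; rewrite addn0 -la in pb lb nb; rewrite taunn g1 in lb.
  (* The far end is not among the cells of the first half, by the choice of d2. *)
  have [|a [mid [b [pw lw sub1 sub2 dis]]]] := split_walk pa (mem_last _ _) pb.
    rewrite lb; apply/negP => /na[i ile ni].
    have := near_cell_dist h0 ni (near_cell_of h0 _); rewrite h3 lt_min => /andP[_].
    by rewrite ltNge sep2 // tau_half.
  exists (a, mid, b); split=> //; first by rewrite lw lb.
  - by move=> z /sub1/na[i ile ni]; exists (tau i); rewrite ?tau_half.
  - move=> z /sub2 zb; have [|i ile ni] := nb z; first by rewrite inE zb orbT.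
    by exists (tau (n + i)%N); rewrite ?tau_half'.
  - by move=> z /dis; apply: contraNN => /sub1.
pose a e := (w e).1.1; pose mid e := (w e).1.2; pose b e := (w e).2.
pose part (t : edge G * bool) :=
  if t.2 then mid t.1 :: b t.1 else pos (src t.1) :: a t.1.
have part_near t z : z \in part t ->
    exists2 s, s \in half t.2 & near_cell h (g t.1 s) z.
  case: t => e []; rewrite /part /= => zt; have := wP e; rewrite /mid /b /a in zt *;
  by case: (w e) zt => [[a' mid'] b'] /= zt [_ _ Ha Hb _]; auto.
have part_disj e z : z \in part (e, true) -> z \in part (e, false) -> False.
  rewrite /part /=; have := wP e; rewrite /mid /b /a.
  by case: (w e) => [[a' mid'] b'] /= [_ _ _ _ D] /D/negP.
pose owner z := omap hown [pick t | z \in part t].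
(* Two parts with different owners share no cell. *)
have ownerP t z : z \in part t -> owner z = Some (hown t).
  move=> zt; rewrite /owner; case: pickP => [t' zt'|/(_ t)]; last by rewrite zt.
  congr Some; apply/eqP; apply: contraT => ht.
  have [et|nt] := eqVneq t'.1 t.1.
    case: t t' zt zt' et ht => [e c] [e' c'] zt zt' /= et; subst e'.
    case: c c' zt zt' => [] [] zt zt'; rewrite ?eqxx // => _.
      by case: (part_disj e z).
    by case: (part_disj e z).
  have [s hs ns] := part_near t z zt; have [s' hs' ns'] := part_near t' z zt'.
  have := near_cell_dist h0 ns' ns; rewrite h3 lt_min => /andP[+ _].
  by rewrite ltNge (sep1 (t', t)).
apply: (@grid_model_euler G F src tgt pos a b mid owner) => // e.
- by have [] := stP e.
- by have := wP e; rewrite /a /mid /b; case: (w e) => [[a' mid'] b'] [].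
- by have := wP e; rewrite /a /mid /b; case: (w e) => [[a' mid'] b'] [].
- by move=> z zt; apply: (ownerP (e, false)).
- by move=> z zt; apply: (ownerP (e, true)).
Qed.

End Drawings.

Theorem theorem14 (R : realType) (G : sgraph)
    (planarG : planar R G) (kite_freeG : kite_free G)
    (degG : 7 <= max_degree G) :
  list_total_chromatic_number G <= max_degree G + 2.
Proof.
rewrite /list_total_chromatic_number; case: ex_minnP => m _; apply.
apply/asboolP/choosable_of_light_edges => // F F0 lightF.
have := planar_euler planarG F0.
have := discharging kite_freeG degG (@deg_max G F) lightF; lia.
Qed.
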